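(* Let $\Gamma$ be a connected ve-srg with parameters $(n,k,\lambda,\mu)$, let $G\le \mathrm{Aut}(\Gamma)$ be transitive on the vertices and on the edges of $\Gamma$, and let $1\neq N\triangleleft G$ be intransitive on $V(\Gamma)$. Suppose the quotient graph satisfies $\Gamma_N\cong K_{m+1}$ (so $m$ is the valency of $\Gamma_N$), and put $\ell=k/m$ and $r=\mu/\ell$. Then either $\Gamma$ is a complete multipartite graph, or the eigenvalues of $\Gamma$ are $$k,\qquad \theta=m-r,\qquad \tau=-\ell.$$ Furthermore, the multiplicities of the eigenvalues $\theta$ and $\tau$ are $$m_\theta=\frac{m\ell(m+1)(\ell-1)}{m-r+\ell},$$ $$m_\tau=\frac{m}{m-r+\ell}\bigl(m^2\ell-m^2+2rm+m\ell-m+\ell rm-r^2+r\bigr),$$ so these values must be integers. The parameters $(n,k,\lambda,\mu)$ of $\Gamma$ are $$\bigl((m+1)(m\ell-m+r)/r,\; m\ell,\; (r-1)\ell+m-r,\; r\ell\bigr).$$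
   Context: A strongly regular graph with parameters $(n,k,\lambda,\mu)$ is a (finite, simple) regular graph with $n$ vertices and valency $k$, such that each pair of adjacent vertices lies in exactly $\lambda$ triangles and each pair of distinct non-adjacent vertices (if such exist) is joined by exactly $\mu$ paths of length 2. The complete graph $K_n$ is regarded as strongly regular with parameters $(n,n-1,n-2,0)$. A ve-srg is a strongly regular graph whose automorphism group is transitive on vertices and transitive on (undirected) edges. Quotient graph: if $G\le\mathrm{Aut}(\Gamma)$ is vertex-transitive and $1\neq N\triangleleft G$ is intransitive on $V(\Gamma)$, then $\Gamma_N$ is the graph whose vertices are the orbits ${}^Nx=\{h(x): h\in N\}$ of $N$ on $V(\Gamma)$, two distinct orbits ${}^Nx,{}^Ny$ being adjacent if and only if some $x'\in{}^Nx$ and some $y'\in{}^Ny$ are adjacent in $\Gamma$. The number $\ell=k/m$ is the number of edges from $x$ to vertices of ${}^Ny$ whenever ${}^Nx$ and ${}^Ny$ are adjacent in $\Gamma_N$. The eigenvalues of $\Gamma$ are the eigenvalues of its adjacency matrix.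
   Formalization: The printed multiplicities are false (3x3 rook graph, m=l=2, r=1, gives m_tau=28/3); the formal version has denominators r(m-r+l) in m_theta and m_tau, and the term -l r m in place of +l r m in m_tau. *)

(* Defs.v *)
From mathcomp Require Import all_boot all_order all_algebra all_fingroup.
From mathcomp Require Import all_field.

Set Implicit Arguments.
Unset Strict Implicit.
Unset Printing Implicit Defensive.

Import GroupScope.

(* A finite simple graph is a symmetric irreflexive relation e on a finType. *)
Definition simple_graph (T : finType) (e : rel T) : Prop :=
  symmetric e /\ irreflexive e.

Definition connected_graph (T : finType) (e : rel T) : Prop :=
  forall x y : T, connect e x y.

Definition edges (T : finType) (e : rel T) : {set {set T}} :=
  [set [set p.1; p.2] | p in [set p : T * T | e p.1 p.2]].

(* The last clause fixes the parameters of K_n, for which mu (and, when n = 1,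
   also lam) is not determined by the counting conditions; the subtraction is
   truncated, so K_1 gets lam = 0. *)
Record srg (T : finType) (e : rel T) (n k lam mu : nat) : Prop := Srg {
  srg_simple : simple_graph e;
  srg_order : #|T| = n;
  srg_valency : forall x, #|[set y | e x y]| = k;
  srg_adjacent : forall x y, e x y -> #|[set z | e x z && e z y]| = lam;
  srg_nonadjacent : forall x y, x != y -> ~~ e x y ->
    #|[set z | e x z && e z y]| = mu;
  srg_complete : (forall x y, x != y -> e x y) -> lam = n - 2 /\ mu = 0
}.

Section GraphAut.
Variables (T : finType) (e : rel T).

Definition graph_aut : {set {perm T}} :=
  [set s : {perm T} | [forall x, forall y, e (s x) (s y) == e x y]].

Lemma graph_autP (s : {perm T}) :
  reflect (forall x y, e (s x) (s y) = e x y) (s \in graph_aut).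
Proof.
rewrite inE; apply: (iffP forallP) => [es x y | es x].
  by have /forallP/(_ y)/eqP := es x.
by apply/forallP=> y; rewrite es.
Qed.

Lemma graph_aut_group_set : group_set graph_aut.
Proof.
apply/group_setP; split=> [|s t /graph_autP es /graph_autP et].
  by apply/graph_autP=> x y; rewrite !perm1.
by apply/graph_autP=> x y; rewrite !permM et es.
Qed.

Canonical graph_aut_group := Group graph_aut_group_set.

Definition vertex_transitive (A : {set {perm T}}) : bool :=
  [transitive A, on [set: T] | 'P].

(* Edges are unordered pairs. [atrans] is not used here because it is false on
   the empty set. *)
Definition edge_transitive (A : {set {perm T}}) : Prop :=
  forall E F, E \in edges e -> F \in edges e -> exists2 s, s \in A & s @: E = F.

End GraphAut.

Definition ve_srg (T : finType) (e : rel T) (n k lam mu : nat) : Prop :=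
  [/\ srg e n k lam mu, vertex_transitive (graph_aut e)
    & edge_transitive e (graph_aut e)].

Definition orbit_type (T : finType) (N : {set {perm T}}) : finType :=
  {X : {set T} | X \in orbit 'P N @: [set: T]}.

Definition quotient_graph (T : finType) (e : rel T) (N : {set {perm T}}) :
    rel (orbit_type N) :=
  fun X Y => (X != Y) && [exists x in val X, exists y in val Y, e x y].

Arguments quotient_graph {T} e N.

Definition complete_graph (n : nat) : rel 'I_n := fun i j => i != j.

Arguments complete_graph n : clear implicits.

Definition graph_iso (T U : finType) (e : rel T) (f : rel U) : Prop :=
  exists2 phi : T -> U, bijective phi & forall x y, f (phi x) (phi y) = e x y.

Definition complete_multipartite (T : finType) (e : rel T) : Prop :=
  exists P : {set {set T}}, [/\ partition P [set: T], 1 < #|P|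
    & forall x y, e x y = (pblock P x != pblock P y)].

Definition adjacency_matrix (T : finType) (e : rel T) : 'M[algC]_#|T| :=
  (\matrix_(i, j) (e (enum_val i) (enum_val j))%:R)%R.

(* The adjacency matrix is real symmetric, so its geometric and algebraic
   multiplicities agree. *)
Definition eigen_multiplicity (T : finType) (e : rel T) (a : algC) : nat :=
  \rank (eigenspace (adjacency_matrix e) a).

(* Main.v *)
Require Import Defs.
From mathcomp Require Import all_boot all_order all_algebra all_fingroup.
From mathcomp Require Import all_field.
From mathcomp Require Import ring.

Set Implicit Arguments.
Unset Strict Implicit.
Unset Printing Implicit Defensive.

Import Order.TTheory GRing.Theory Num.Theory.
Local Open Scope ring_scope.

(** The orbits of N are permuted transitively by G. Since G is transitive on
    edges and the graph is connected, no edge lies inside an orbit; and since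
    the quotient is complete, every vertex has the same number l > 0 of
    neighbours in each of the m orbits other than its own
    ([nbrs_in_orbitE]). Hence k = m l, and the indicator of one orbit minus
    that of another is an eigenvector for tau = - l
    ([orbit_difference_eigenvalue]).

    Strong regularity says that A ^ 2 is a combination of A, the identity and
    the all-ones matrix J, so that off the all-ones vector A satisfies a
    quadratic equation with root sum lam - mu and root product mu - k. Knowing
    one root, - l, gives the other one, theta = (k - mu) / l = m - r, and then
    lam from the root sum. Applying the quadratic relation to the all-ones
    vector gives n ([quadratic_ones_coef]).

    The projection onto the theta-eigenspace is a linear combination of A, the
    identity and J, so its rank is its trace, which is explicit because
    A has trace 0 ([quadratic_rank_eigenspace]); the same holds for tau. All
    divisions are legitimate: a non-identity element of N puts two vertices in
    one orbit, so the graph is not complete, and connectedness gives mu > 0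
    ([connected_srg_mu_gt0]), whence 0 < r <= m.

    The three listed eigenvalues are always the exact spectrum, even for
    complete multipartite graphs: theta has multiplicity 0 only if l = 1, in
    which case n = m + 1 and the orbits of N would be single vertices. *)

(** * Matrices annihilated by a quadratic modulo the all-ones matrix *)

(** The full-rank factorization E = C R turns the idempotence of E into
    R C = 1, and the trace of C R equals that of R C. *)
Lemma mxtrace_idempotent (F : fieldType) (n : nat) (E : 'M[F]_n) :
  E *m E = E -> \tr E = (\rank E)%:R.
Proof.
move=> EE.
move: (col_base E) (row_base E) (mulmx_base E) (col_base_full E)
  (row_base_free E) => C R CR C_full R_free.
have RC : R *m C = 1%:M.
  apply: (row_full_inj C_full); apply: (row_free_inj R_free).
  by rewrite /= mulmx1 !mulmxA CR -mulmxA CR EE.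
by rewrite -[X in \tr X]CR mxtrace_mulC RC mxtrace1.
Qed.

Section QuadraticModuloAllOnes.

Variables (F : fieldType) (n : nat) (A : 'M[F]_n) (k theta tau c : F).
Let J : 'M[F]_n := const_mx 1.

Hypothesis AJ : A *m J = k *: J.
Hypothesis JA : J *m A = k *: J.
(** The all-ones column is an eigenvector for k, and a left eigenvector and a
    right eigenvector for different eigenvalues are orthogonal. *)
Lemma eigenvector_mul_ones p (a : F) (W : 'M[F]_(p, n)) :
  a != k -> W *m A = a *: W -> W *m J = 0.
Proof.
move=> ak WA; apply/eqP.
have : (a - k) *: (W *m J) == 0.
  by rewrite scalerBl scalemxAl -WA -mulmxA AJ -scalemxAr subrr.
by rewrite scaler_eq0 subr_eq0 (negPf ak).
Qed.

Lemma eigenvalue_root_quadratic (s p a : F) :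
  A *m A = s *: A - p%:M + c *: J ->
  eigenvalue A a -> a != k -> a * a = s * a - p.
Proof.
move=> AA /eigenvalueP[v vA v0] ak; apply/eqP; rewrite -subr_eq0.
have vJ := eigenvector_mul_ones ak vA.
have vAA : v *m (A *m A) = (a * a) *: v.
  by rewrite mulmxA vA -scalemxAl vA scalerA.
rewrite AA mulmxDr mulmxBr -!scalemxAr vJ vA mul_mx_scalar in vAA.
have : (a * a - (s * a - p)) *: v == 0.
  by rewrite scalerBl -vAA scaler0 addr0 scalerA -scalerBl subrr.
by rewrite scaler_eq0 (negPf v0) orbF.
Qed.

Hypothesis A_quadratic :
  A *m A = (theta + tau) *: A - (theta * tau)%:M + c *: J.

Lemma quadratic_eigenvalues (a : F) :
  eigenvalue A a -> [\/ a = k, a = theta | a = tau].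
Proof.
move=> Aa; have [-> | ak] := eqVneq a k; first by constructor 1.
have aa := eigenvalue_root_quadratic A_quadratic Aa ak.
have /eqP : (a - theta) * (a - tau) = 0 by rewrite mulrBl !mulrBr aa; ring.
rewrite mulf_eq0 !subr_eq0.
by case/orP=> /eqP->; [constructor 2 | constructor 3].
Qed.

Hypothesis n_neq0 : n%:R != 0 :> F.

Lemma mul_ones_ones : J *m J = n%:R *: J.
Proof.
apply/matrixP=> i j; rewrite !mxE mulr1 (eq_bigr (fun=> 1)) => [|t _].
  by rewrite sumr_const card_ord.
by rewrite !mxE mulr1.
Qed.

(** Compare the actions of both sides of the quadratic relation on the
    all-ones vector. *)
Lemma quadratic_ones_coef : c * n%:R = (k - theta) * (k - tau).
Proof.
have n_gt0 : (0 < n)%N by case: n n_neq0; rewrite ?mulr0n ?eqxx.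
have := congr1 (mulmx^~ J) A_quadratic.
rewrite /= -mulmxA AJ mulmxDl mulmxBl -!scalemxAl -!scalemxAr !AJ.
rewrite mul_scalar_mx mul_ones_ones => /matrixP/(_ (Ordinal n_gt0)).
move=> /(_ (Ordinal n_gt0)); rewrite !mxE !mulr1 => e1.
have -> : (k - theta) * (k - tau) =
  k * k - (theta + tau) * k + theta * tau by ring.
by rewrite e1; ring.
Qed.

Hypothesis theta_neq_tau : theta != tau.
Hypothesis theta_neq_k : theta != k.

(** The matrix A - tau kills the tau-eigenvectors, and subtracting its part on
    the all-ones vector leaves a multiple of the projection onto the
    theta-eigenspace, whose rank can be read off from its trace. *)
Lemma quadratic_rank_eigenspace :
  (\rank (eigenspace A theta))%:R =
  (\tr A - tau * n%:R - (k - tau)) / (theta - tau).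
Proof.
have d0 : theta - tau != 0 by rewrite subr_eq0.
pose E := (theta - tau)^-1 *: (A - tau%:M - ((k - tau) / n%:R) *: J).
have EA : E *m A = theta *: E.
  rewrite /E -scalemxAl !mulmxBl -scalemxAl A_quadratic JA mul_scalar_mx.
  have -> : c = (k - theta) * (k - tau) / n%:R.
    by rewrite -quadratic_ones_coef mulfK.
  rewrite -[tau%:M]scalemx1 -[(theta * tau)%:M]scalemx1.
  apply/matrixP=> i j; rewrite !mxE; set d : F := (i == j)%:R.
  by field; rewrite n_neq0 d0.
have E_id p (W : 'M[F]_(p, n)) : W *m A = theta *: W -> W *m E = W.
  move=> WA; have WJ := eigenvector_mul_ones theta_neq_k WA.
  rewrite /E -scalemxAr !mulmxBr WA -scalemxAr WJ scaler0 subr0.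
  by rewrite mul_mx_scalar -scalerBl scalerA mulVf // scale1r.
have -> : \rank (eigenspace A theta) = \rank E.
  apply: eqmx_rank; apply/andP; split; last exact/eigenspaceP.
  by rewrite -[X in (X <= _)%MS]E_id ?submxMl //; apply/eigenspaceP.
rewrite -mxtrace_idempotent ?E_id // /E linearZ /= !linearB /= linearZ /=.
rewrite mxtrace_scalar.
have -> : \tr J = n%:R.
  rewrite /mxtrace (eq_bigr (fun=> 1)) => [|i _]; last by rewrite mxE.
  by rewrite sumr_const card_ord.
by rewrite divfK // -[tau *+ n]mulr_natr mulrC.
Qed.

End QuadraticModuloAllOnes.

(** * Adjacency matrices of strongly regular graphs *)

Section SrgAdjacency.

Variables (T : finType) (e : rel T).
Local Notation A := (adjacency_matrix e).
Local Notation J := (const_mx 1 : 'M[algC]_#|T|).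

Lemma sum_adjacency (f : T -> bool) (x : T) :
  \sum_(t < #|T|) (e x (enum_val t))%:R * (f (enum_val t))%:R
    = #|[set z | e x z && f z]|%:R :> algC.
Proof.
rewrite -sum1dep_card natr_sum [RHS]big_mkcond /=.
rewrite [RHS](reindex _ (onW_bij _ (enum_val_bij T))) /=.
by apply: eq_bigr => t _; rewrite -natrM mulnb; case: (_ && _).
Qed.

Variables (n k lam mu : nat).
Hypothesis e_srg : srg e n k lam mu.

Lemma adjacency_mul_ones : A *m J = k%:R *: J.
Proof.
apply/matrixP=> i j; rewrite !mxE mulr1.
rewrite -(srg_valency e_srg (enum_val i)).
have -> : [set y | e (enum_val i) y] = [set y | e (enum_val i) y && true].
  by apply/setP=> y; rewrite !inE andbT.
rewrite -(sum_adjacency xpredT).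
by apply: eq_bigr => t _; rewrite !mxE.
Qed.

Lemma adjacency_symmetric : A^T = A.
Proof.
have [e_sym _] := srg_simple e_srg.
by apply/matrixP=> i j; rewrite !mxE e_sym.
Qed.

Lemma ones_mul_adjacency : J *m A = k%:R *: J.
Proof.
have JT : J^T = J by apply/matrixP=> i j; rewrite !mxE.
by apply: trmx_inj; rewrite trmx_mul linearZ /= JT adjacency_symmetric
  adjacency_mul_ones.
Qed.

Lemma mxtrace_adjacency : \tr A = 0.
Proof.
have [_ e_irr] := srg_simple e_srg.
by rewrite /mxtrace big1 // => i _; rewrite mxE e_irr.
Qed.

(** Entry (x, y) of A ^ 2 counts the paths of length 2 from x to y: there are
    k, lam or mu of them according as x and y are equal, adjacent or neither. *)
Lemma adjacency_quadratic :
  A *m A = (lam%:R - mu%:R) *: A - (mu%:R - k%:R)%:M + mu%:R *: J.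
Proof.
have [e_sym e_irr] := srg_simple e_srg.
apply/matrixP=> i j; rewrite !mxE.
under eq_bigr do rewrite !mxE.
rewrite (sum_adjacency (e^~ (enum_val j))) -(inj_eq enum_val_inj).
have [-> | ij] := eqVneq.
  rewrite e_irr mulr0n mulr1n mulr0 mulr1 -(srg_valency e_srg (enum_val j)).
  have -> : [set z | e (enum_val j) z && e z (enum_val j)] =
      [set z | e (enum_val j) z].
    by apply/setP=> z; rewrite !inE [e z _]e_sym andbb.
  by ring.
have [eij | eij] := boolP (e _ _).
  by rewrite (srg_adjacent e_srg eij) mulr0n mulr1 mulr1n; ring.
by rewrite (srg_nonadjacent e_srg ij eij) !mulr0n mulr0; ring.
Qed.

End SrgAdjacency.

(** * Orbits of a normal subgroup of an edge-transitive group *)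

Section NormalOrbits.

Variables (T : finType) (e : rel T) (G N : {group {perm T}}).
Local Notation orb := (orbit 'P N).

Hypothesis e_sym : symmetric e.
Hypothesis G_aut : G \subset graph_aut e.
Hypothesis G_vertex : vertex_transitive G.
Hypothesis G_edge : edge_transitive e G.
Hypothesis N_normal : (N <| G)%g.

Definition nbrs_in_orbit (x y : T) : nat := #|[set z | e x z && (z \in orb y)]|.

Lemma normal_orbit_perm (s : {perm T}) x y :
  s \in G -> (s x \in orb (s y)) = (x \in orb y).
Proof.
have imp t u v : t \in G -> u \in orb v -> t u \in orb (t v).
  move=> tG /orbitP[h hN <-]; apply/orbitP; exists (h ^ t)%g.
    by rewrite memJ_norm // (subsetP (normal_norm N_normal)).
  by rewrite /= !apermE -!permM -conjgC.
move=> sG; apply/idP/idP; last exact: imp.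
by move/(imp _ _ _ (groupVr sG)); rewrite !permK.
Qed.

Lemma nbrs_in_orbit_perm (s : {perm T}) x y :
  s \in G -> nbrs_in_orbit (s x) (s y) = nbrs_in_orbit x y.
Proof.
move=> sG; have /graph_autP s_aut := subsetP G_aut s sG.
rewrite /nbrs_in_orbit -!sum1dep_card (reindex_inj (@perm_inj _ s)).
by apply: eq_bigl => z; rewrite s_aut normal_orbit_perm.
Qed.

Lemma nbrs_in_orbit_l x x' y :
  x' \in orb x -> nbrs_in_orbit x' y = nbrs_in_orbit x y.
Proof.
case/orbitP=> h hN <-; have hG := subsetP (normal_sub N_normal) h hN.
rewrite /= apermE -(nbrs_in_orbit_perm x y hG) /nbrs_in_orbit.
have -> // : orb (h y) = orb y.
by apply/orbit_eqP/orbitP; exists h.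
Qed.

Lemma nbrs_in_orbit_r x y y' :
  y' \in orb y -> nbrs_in_orbit x y' = nbrs_in_orbit x y.
Proof. by move/orbit_eqP=> orby; rewrite /nbrs_in_orbit orby. Qed.

(** Both sides count the edges between two orbits, which have the same size
    because G permutes the orbits transitively. *)
Lemma nbrs_in_orbit_sym x y : nbrs_in_orbit x y = nbrs_in_orbit y x.
Proof.
have cardO : #|orb x| = #|orb y|.
  have : y \in orbit 'P G x by rewrite (atransP G_vertex).
  case/orbitP=> s sG <-; rewrite /= apermE.
  rewrite -(card_imset _ (@perm_inj _ s)); apply: eq_card => z.
  rewrite -[z in RHS](permKV s) normal_orbit_perm //.
  by rewrite -[z in LHS](permKV s) mem_imset //; exact: perm_inj.
have count u v : (#|orb u| * nbrs_in_orbit u v =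
    \sum_(a in orb u) \sum_(b in orb v) e a b)%N.
  rewrite -sum_nat_const; apply: eq_bigr => a au.
  rewrite -(nbrs_in_orbit_l v au) /nbrs_in_orbit -sum1dep_card.
  by rewrite big_mkcondl /=; apply: eq_bigr => b _; case: (e a b).
have O_gt0 : (0 < #|orb x|)%N by apply/card_gt0P; exists x; apply: orbit_refl.
apply/eqP; rewrite -(eqn_pmul2l O_gt0) {2}cardO !count exchange_big /=.
by apply/eqP/eq_bigr => a _; apply: eq_bigr => b _; rewrite e_sym.
Qed.

(** G moves unordered edges, so the two ends may be swapped. *)
Lemma edge_transitive_ends x y x' y' : e x y -> e x' y' ->
  exists2 s, s \in G & (s x = x' /\ s y = y') \/ (s x = y' /\ s y = x').
Proof.
have mem u v : e u v -> [set u; v] \in edges e.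
  by move=> uv; apply/imsetP; exists (u, v); rewrite ?inE.
move=> xy xy'; have [s sG] := G_edge (mem _ _ xy) (mem _ _ xy').
rewrite imsetU1 imset_set1 => sE; exists s => //.
have : x' \in [set s x; s y] by rewrite sE set21.
have : y' \in [set s x; s y] by rewrite sE set22.
have : s x \in [set x'; y'] by rewrite -sE set21.
have : s y \in [set x'; y'] by rewrite -sE set22.
rewrite !inE => /orP[]/eqP-> /orP[]/eqP->; rewrite ?orbb.
- by move=> /eqP-> _; left.
- by right.
- by left.
- by move=> _ /eqP->; left.
Qed.

(** When the automorphism carrying one edge to the other swaps the ends, the
    symmetry of the count makes up for it. *)
Lemma nbrs_in_orbit_edge x y x' y' :
  e x y -> e x' y' -> nbrs_in_orbit x y = nbrs_in_orbit x' y'.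
Proof.
move=> xy xy'; have [s sG sE] := edge_transitive_ends xy xy'.
rewrite -(nbrs_in_orbit_perm x y sG).
by case: sE => -[-> ->] //; apply: nbrs_in_orbit_sym.
Qed.

Hypothesis e_connected : connected_graph e.
Hypothesis N_intransitive : ~~ vertex_transitive N.

(** One edge inside an orbit would force all edges to lie inside orbits, and
    connectedness would then leave a single orbit. *)
Lemma edge_leaves_orbit x y : e x y -> y \notin orb x.
Proof.
move=> xy; apply/negP=> yx.
have inside u v : e u v -> v \in orb u.
  move=> uv; have [s sG sE] := edge_transitive_ends xy uv.
  have : s y \in orb (s x) by rewrite normal_orbit_perm.
  by case: sE => -[-> ->] //; rewrite orbit_sym.
case/negP: N_intransitive; apply/imsetP; exists x; first by rewrite inE.
apply/setP=> z; rewrite inE; apply/esym.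
case/connectP: (e_connected x z) => p; elim: p x {xy yx} => [|w p IH] x /=.
  by move=> _ ->; apply: orbit_refl.
case/andP=> xw wp zlast; apply: (orbit_trans _ (inside _ _ xw)).
exact: IH.
Qed.

Hypothesis quotient_complete : forall X Y : orbit_type N,
  X != Y -> quotient_graph e N X Y.

Let orbit_elt x : orbit_type N := Sub (orb x) (imset_f orb (in_setT x)).

(** Completeness of the quotient provides an edge between the orbits of x and
    y, and the count depends only on the two orbits. *)
Lemma nbrs_in_other_orbit x y a b :
  e a b -> y \notin orb x -> nbrs_in_orbit x y = nbrs_in_orbit a b.
Proof.
move=> ab yx.
have /quotient_complete /andP[_] : orbit_elt x != orbit_elt y.
  by apply: contra yx; rewrite -val_eqE /= orbit_eq_mem orbit_sym.
case/existsP=> x' /andP[x'x /existsP[y' /andP[y'y xy]]].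
rewrite -(nbrs_in_orbit_l _ x'x) -(nbrs_in_orbit_r _ y'y).
exact: nbrs_in_orbit_edge.
Qed.

Lemma nbrs_in_orbitE x y a b : e a b ->
  nbrs_in_orbit x y = (nbrs_in_orbit a b * (x \notin orb y))%N.
Proof.
move=> ab; case: (boolP (x \in orb y)) => [xy | xy] /=.
  rewrite muln0; apply/eqP; rewrite cards_eq0; apply/eqP/setP=> z.
  rewrite !inE; apply/negP=> /andP[xz zy]; case/negP: (edge_leaves_orbit xz).
  by rewrite (orbit_eqP xy).
by rewrite muln1; apply: nbrs_in_other_orbit; rewrite // orbit_sym.
Qed.

Lemma card_orbit_type : #|{: orbit_type N}| = #|orb @: [set: T]|.
Proof. by rewrite card_sig; apply: eq_card => X; rewrite !inE. Qed.

(** Sort the neighbours of x by orbit: its own orbit contains none of them. *)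
Lemma valency_nbrs_in_orbit x a b : e a b ->
  #|[set z | e x z]| = (#|{: orbit_type N}|.-1 * nbrs_in_orbit a b)%N.
Proof.
move=> ab; rewrite -sum1dep_card.
rewrite (partition_big orb (mem (orb @: [set: T]))) => [|z _]; last first.
  exact: imset_f.
rewrite (bigD1 (orb x)) /= ?imset_f //.
have sumE y : \sum_(z | e x z && (orb z == orb y)) 1 = nbrs_in_orbit x y.
  by rewrite sum1dep_card; apply: eq_card => z; rewrite !inE orbit_eq_mem.
rewrite sumE (nbrs_in_orbitE _ _ ab) orbit_refl muln0 add0n.
rewrite (eq_bigr (fun=> nbrs_in_orbit a b)) => [|Y /andP[/imsetP[y _ ->] yx]].
  rewrite sum_nat_const card_orbit_type.
  rewrite (cardD1 (orb x) (mem (orb @: [set: T]))) imset_f ?inE //=.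
  by congr (_ * _)%N; apply: eq_card => Y; rewrite !inE andbC.
rewrite sumE; apply: nbrs_in_other_orbit => //.
by apply: contra yx; rewrite -orbit_eq_mem.
Qed.

End NormalOrbits.

(** * The spectrum of a strongly regular cover of a complete graph *)

(** The indicator of one orbit minus that of another is an eigenvector:
    a vertex has no neighbour in its own orbit and equally many in every other
    one. *)
Lemma orbit_difference_eigenvalue (T : finType) (e : rel T)
    (N : {group {perm T}}) (l : nat) (a b : T) :
  symmetric e ->
  (forall x y, nbrs_in_orbit e N x y = l * (x \notin orbit 'P N y))%N ->
  b \notin orbit 'P N a ->
  eigenvalue (adjacency_matrix e) (- l%:R).
Proof.
move=> e_sym nbrsE ba; apply/eigenvalueP.
pose ind y z : algC := (z \in orbit 'P N y)%:R.
exists (\row_i (ind a (enum_val i) - ind b (enum_val i))).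
  apply/rowP=> j; rewrite !mxE.
  have sum_ind y : \sum_(i < #|T|) ind y (enum_val i) *
      (e (enum_val i) (enum_val j))%:R = l%:R * (1 - ind y (enum_val j)).
    under eq_bigr do rewrite mulrC e_sym.
    rewrite (sum_adjacency _ (fun z => z \in orbit 'P N y)).
    rewrite -/(nbrs_in_orbit e N (enum_val j) y) nbrsE natrM /ind.
    by case: (_ \in _); rewrite /= ?subrr ?subr0.
  under eq_bigr do rewrite !mxE mulrBl.
  by rewrite sumrB !sum_ind; ring.
apply/eqP=> /rowP/(_ (enum_rank a)); rewrite !mxE enum_rankK /ind.
rewrite orbit_refl orbit_sym (negPf ba) subr0 => /eqP.
by rewrite oner_eq0.
Qed.

(** If mu were 0, adjacency or equality would be a transitive relation, and
    connectedness would make the graph complete. *)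
Lemma connected_srg_mu_gt0 (T : finType) (e : rel T) (n k lam mu : nat) x y :
  srg e n k lam mu -> connected_graph e -> x != y -> ~~ e x y -> (0 < mu)%N.
Proof.
move=> e_srg e_conn xy nxy; rewrite lt0n; apply/negP=> /eqP mu0.
have e_step u v w : u != w -> e u v -> e v w -> e u w.
  move=> uw uv vw; apply/negPn/negP=> nuw.
  have := srg_nonadjacent e_srg uw nuw; rewrite mu0 => /eqP.
  by rewrite cards_eq0 => /eqP/setP/(_ v); rewrite !inE uv vw.
case/connectP: (e_conn x y) => p; elim/last_ind: p y xy nxy => [|p w IH] y.
  by move=> xy _ _ yx; rewrite yx eqxx in xy.
move=> xy nxy; rewrite rcons_path last_rcons => /andP[xp pw] yw.
rewrite -{w}yw in pw; case/negP: nxy.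
have [xl | xl] := eqVneq x (last x p); first by rewrite {1}xl.
have [xe | nxe] := boolP (e x (last x p)); first exact: (e_step _ (last x p)).
by case: (IH _ xl nxe xp).
Qed.

Theorem proposition3p8 (T : finType) (e : rel T) (n k lam mu : nat)
    (G N : {group {perm T}}) (m : nat) :
  ve_srg e n k lam mu ->
  connected_graph e ->
  G \subset graph_aut e ->
  vertex_transitive G ->
  edge_transitive e G ->
  (N <| G)%g ->
  N :!=: 1%g ->
  ~~ vertex_transitive N ->
  graph_iso (quotient_graph e N) (complete_graph m.+1) ->
  let M : algC := m%:R in
  let l : algC := k%:R / M in
  let r : algC := mu%:R / l in
  let theta : algC := M - r in
  let tau : algC := - l in
  let m_theta : algC :=
    M * l * (M + 1) * (l - 1) / (r * (M - r + l)) in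
  let m_tau : algC :=
    M / (r * (M - r + l)) *
      (M ^+ 2 * l - M ^+ 2 + 2 * r * M + M * l - M - l * r * M - r ^+ 2 + r) in
  [/\ complete_multipartite e \/
        (forall a : algC, eigenvalue (adjacency_matrix e) a <->
           [\/ a = k%:R, a = theta | a = tau]),
      [/\ (eigen_multiplicity e theta)%:R = m_theta,
          (eigen_multiplicity e tau)%:R = m_tau,
          m_theta \is a Num.int
        & m_tau \is a Num.int]
    & [/\ n%:R = (M + 1) * (M * l - M + r) / r,
          k%:R = M * l,
          lam%:R = (r - 1) * l + M - r
        & mu%:R = r * l]].
Proof.
move=> [e_srg _ _] e_conn G_aut G_vertex G_edge N_normal N_neq1 N_intr.
case=> phi phi_bij phiE M l r theta tau m_theta m_tau.
have [e_sym _] := srg_simple e_srg.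
have card_Q : #|{: orbit_type N}| = m.+1.
  by rewrite (bij_eq_card phi_bij) card_ord.
have Q_complete (X Y : orbit_type N) : X != Y -> quotient_graph e N X Y.
  by move=> XY; rewrite -phiE /complete_graph (inj_eq (bij_inj phi_bij)).
(* A non-identity element of N provides two vertices in one orbit. *)
have [x [y xy xyN]] : exists x, exists2 y, x != y & y \in orbit 'P N x.
  have /trivgPn[h hN h1] := N_neq1.
  have /existsP[x hx] : [exists x, h x != x].
    apply: contraR h1 => /existsPn h1; apply/eqP/permP=> z.
    by rewrite perm1; apply/eqP/negPn/h1.
  by exists x, (h x); [rewrite eq_sym | apply/orbitP; exists h].
have [a ab] : exists a, e x a.
  case/connectP: (e_conn x y) => -[|a p] /=; last by case/andP; exists a.
  by move=> _ yx; rewrite yx eqxx in xy.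
have nbrsE u v :=
  nbrs_in_orbitE e_sym G_aut G_vertex G_edge N_normal e_conn N_intr
    Q_complete u v ab.
have kE := valency_nbrs_in_orbit e_sym G_aut G_vertex G_edge N_normal e_conn
  N_intr Q_complete x ab.
have l0_gt0 : (0 < nbrs_in_orbit e N x a)%N.
  by apply/card_gt0P; exists a; rewrite inE ab orbit_refl.
move: (nbrs_in_orbit e N x a) l0_gt0 nbrsE kE => l0 l0_gt0 nbrsE kE.
rewrite (srg_valency e_srg) card_Q /= in kE.
have k_gt0 : (0 < k)%N.
  by rewrite -(srg_valency e_srg x); apply/card_gt0P; exists a; rewrite inE.
have m_gt0 : (0 < m)%N by move: k_gt0; rewrite kE; case: (m).
have m_lt_n : (m.+1 < #|T|)%N.
  rewrite -card_Q card_orbit_type -cardsT ltn_neqAle leq_imset_card andbT.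
  apply/imset_injP=> orb_inj; case/eqP: xy; apply: orb_inj; rewrite ?inE //.
  by apply/esym/orbit_eqP.
have nxy : ~~ e x y.
  apply: contraL xyN.
  exact: (edge_leaves_orbit G_edge N_normal e_conn N_intr).
have mu_gt0 := connected_srg_mu_gt0 e_srg e_conn xy nxy.
have mu_le_k : (mu <= k)%N.
  rewrite -(srg_nonadjacent e_srg xy nxy) -(srg_valency e_srg x).
  by apply/subset_leq_card/subsetP=> z; rewrite !inE => /andP[].
have M_gt0 : 0 < M by rewrite ltr0n.
have lE : l = l0%:R by rewrite /l kE natrM -/M mulrC mulKf ?gt_eqF.
have l_ge1 : 1 <= l by rewrite lE ler1n.
have l_gt0 : 0 < l := lt_le_trans ltr01 l_ge1.
have r_gt0 : 0 < r by rewrite divr_gt0 ?ltr0n.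
have kMl : k%:R = M * l by rewrite kE natrM lE.
have muE : mu%:R = r * l by rewrite divfK ?gt_eqF.
have r_le_M : r <= M by rewrite ler_pdivrMr // -kMl ler_nat.
have d_gt0 : 0 < M - r + l by rewrite ltr_wpDl ?subr_ge0.
have tau_eigen : eigenvalue (adjacency_matrix e) tau.
  rewrite /tau lE; apply: (@orbit_difference_eigenvalue _ _ N _ x a) => //.
  exact: (edge_leaves_orbit G_edge N_normal e_conn N_intr).
have tau_neq_k : tau != k%:R.
  by rewrite lt_eqF // (@lt_trans _ _ 0) ?oppr_lt0 ?ltr0n.
have theta_neq_k : theta != k%:R.
  rewrite lt_eqF // (@lt_le_trans _ _ M) ?gtrBl // kMl.
  by rewrite ler_peMr // ltW.
have theta_neq_tau : theta != tau by rewrite -subr_eq0 opprK gt_eqF.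
have AJ := adjacency_mul_ones e_srg.
have JA := ones_mul_adjacency e_srg.
have AA := adjacency_quadratic e_srg.
have n_neq0 : #|T|%:R != 0 :> algC.
  by rewrite pnatr_eq0 -lt0n (leq_ltn_trans _ m_lt_n).
(* tau is a root of the quadratic; dividing the equation by l gives lam. *)
have lamE : lam%:R = (r - 1) * l + M - r.
  have := eigenvalue_root_quadratic AJ AA tau_eigen tau_neq_k.
  rewrite kMl muE /tau => root_l; apply: (mulIf (lt0r_neq0 l_gt0)).
  have -> : lam%:R * l = r * l * l - r * l + M * l -
    ((lam%:R - r * l) * - l - (r * l - M * l)) by ring.
  by rewrite -root_l; ring.
have sumE : lam%:R - mu%:R = theta + tau.
  by rewrite lamE muE /theta /tau; ring.
have prodE : mu%:R - k%:R = theta * tau.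
  by rewrite muE kMl /theta /tau; ring.
rewrite sumE prodE in AA.
have nE : #|T|%:R = (M + 1) * (M * l - M + r) / r.
  have := quadratic_ones_coef AJ AA n_neq0.
  rewrite muE kMl /theta /tau => coefE.
  apply: (mulfI (lt0r_neq0 (mulr_gt0 r_gt0 l_gt0))); rewrite coefE.
  by field; rewrite gt_eqF.
have thetaE : (eigen_multiplicity e theta)%:R = m_theta.
  rewrite /eigen_multiplicity.
  rewrite (quadratic_rank_eigenspace AJ JA AA n_neq0 theta_neq_tau) //.
  rewrite (mxtrace_adjacency e_srg) nE kMl /m_theta /theta /tau.
  by field; rewrite !gt_eqF.
have tauE : (eigen_multiplicity e tau)%:R = m_tau.
  (* The quadratic relation is symmetric in theta and tau. *)
  rewrite [theta + tau]addrC [theta * tau]mulrC in AA.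
  rewrite /eigen_multiplicity.
  rewrite (quadratic_rank_eigenspace AJ JA AA n_neq0 _ tau_neq_k); last first.
    by rewrite eq_sym.
  rewrite (mxtrace_adjacency e_srg) nE kMl /m_tau /theta /tau.
  by field; rewrite -opprD oppr_eq0 [l + _]addrC !gt_eqF.
split.
- right=> c; split; first exact: (quadratic_eigenvalues AJ AA).
  case=> -> //.
  + apply/eigenvalueP; exists (row (enum_rank x) (const_mx 1)).
      by rewrite -row_mul JA linearZ.
    apply/eqP=> /rowP/(_ (enum_rank x)); rewrite !mxE => /eqP.
    by rewrite oner_eq0.
  + rewrite /eigenvalue -mxrank_eq0 -(@pnatr_eq0 algC) [X in X != 0]thetaE.
    (* If l = 1, then n = m + 1, but some orbit has two elements. *)
    have l_neq1 : l != 1.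
      apply: contraTneq m_lt_n => l1; rewrite -leqNgt -(ler_nat algC) nE l1.
      by rewrite mulr1 subrr add0r mulfK ?gt_eqF // natr1.
    have l_gt1 : 1 < l by rewrite lt_neqAle eq_sym l_neq1.
    clearbody r l; rewrite /m_theta.
    by rewrite gt_eqF // divr_gt0 ?mulr_gt0 ?subr_gt0 // addr_gt0.
- by split=> //; rewrite -?thetaE -?tauE; apply/intr_nat.
- by split=> //; rewrite -(srg_order e_srg).
Qed.
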